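(* Let $p$ be an odd prime, let $V$ be a $3$-dimensional vector space over $\mathbb{F}_p$, and let $\pi:V\to\Lambda^2V$ be a linear map of rank one. Then there exists a basis $v_1,v_2,v_3$ of $V$ such that $v_2^\pi=v_3^\pi=1$ and $v_1^\pi$ is one of $$(v_1\wedge v_2),\qquad (v_2\wedge v_3).$$
   Context: Linear maps are written as exponents; addition in $V$ and in its exterior square $\Lambda^2V$ is written multiplicatively (so $1$ denotes the zero vector). *)

(* Defs.v *)
From HB Require Import structures.
From mathcomp Require Import all_boot all_order all_algebra.
From mathcomp Require Import zify ring.

Set Implicit Arguments.
Unset Strict Implicit.
Unset Printing Implicit Defensive.

Import GRing.Theory.
Local Open Scope ring_scope.

Definition alternating (F : fieldType) (V W : lmodType F) (f : V -> V -> W) :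
  Prop := forall v, f v v = 0.

(* W, with the product wedge, is the exterior square of V: wedge is the
   universal alternating bilinear map on V.  Uniqueness of the factorization
   is stated pointwise, so that it needs no extensionality axiom. *)
Definition is_exterior_square (F : fieldType) (V W : lmodType F)
    (wedge : {bilinear V -> V -> W}) : Prop :=
  alternating wedge /\
  forall (Z : lmodType F) (f : {bilinear V -> V -> Z}), alternating f ->
    exists g : {linear W -> Z},
      (forall u v, g (wedge u v) = f u v) /\
      (forall g' : {linear W -> Z},
         (forall u v, g' (wedge u v) = f u v) -> g' =1 g).

(* Every finite-dimensional space has an exterior square: in coordinates, the
   family of 2 x 2 minors u_i v_j - u_j v_i for i < j. *)
Section Existence.

Variables (F : fieldType) (V : vectType F).

Let n := \dim {:V}.
Let e : n.-tuple V := vbasis {:V}.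
Let I := {p : 'I_n * 'I_n | (p.1 < p.2)%N}.

Definition coord_wedge (u v : V) : {ffun I -> F^o} :=
  [ffun p => coord e (val p).1 u * coord e (val p).2 v
           - coord e (val p).2 u * coord e (val p).1 v].

Fact coord_wedge_bilinear :
  bilinear_for (GRing.Scale.Law.clone _ _ *:%R _)
    (GRing.Scale.Law.clone _ _ *:%R _) coord_wedge.
Proof.
by split=> w a u v; apply/ffunP=> p; rewrite !ffunE !linearP /= /GRing.scale /=;
  ring.
Qed.

HB.instance Definition _ :=
  bilinear_isBilinear.Build F V V {ffun I -> F^o} _ _ coord_wedge
    coord_wedge_bilinear.

Fact exterior_square_exists :
  exists (W : vectType F) (wedge : {bilinear V -> V -> W}),
    is_exterior_square wedge.
Proof.
exists {ffun I -> F^o}, coord_wedge; split=> [v|Z f f_alt].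
  by apply/ffunP=> p; rewrite !ffunE mulrC subrr.
have fN u v : f v u = - f u v.
  apply/eqP; rewrite -addr_eq0; apply/eqP.
  have := f_alt (u + v); rewrite linearDr !linearDl /= !f_alt.
  by rewrite add0r addr0 addrC.
pose h (w : {ffun I -> F^o}) : Z :=
  \sum_(p : I) w p *: f e`_(val p).1 e`_(val p).2.
have h_lin : linear h.
  move=> a u v; rewrite /h scaler_sumr -big_split; apply: eq_bigr => p _.
  by rewrite !ffunE scalerDl scalerA.
pose hM := GRing.isLinear.Build _ _ _ _ h h_lin.
pose g : {linear {ffun I -> F^o} -> Z} := HB.pack h hM.
have eE (u : V) : u = \sum_(i < n) coord e i u *: e`_i.
  exact: (coord_vbasis (memvf u)).
exists g; split=> [u v | g' g'E w].
  rewrite [in RHS](eE u) [in RHS](eE v) /= /h.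
  rewrite linear_sumlz; under [RHS]eq_bigr do rewrite linear_sumr.
  have aE i j : f (coord e i u *: e`_i) (coord e j v *: e`_j) =
      (coord e i u * coord e j v) *: f e`_i e`_j.
    by rewrite linearZr_LR linearZl_LR scalerA mulrC.
  rewrite pair_bigA /= (bigID (fun p : 'I_n * 'I_n => p.1 < p.2)%N) /=.
  rewrite [X in _ + X](bigID (fun p : 'I_n * 'I_n => p.2 < p.1)%N) /=.
  rewrite [X in _ + (_ + X)]big1 ?addr0; last first.
    case=> i j /=; rewrite -!leqNgt -eqn_leq => /eqP/val_inj ->.
    by rewrite aE f_alt scaler0.
  rewrite [X in _ + X](reindex (fun p : 'I_n * 'I_n => (p.2, p.1))) /=; last first.
    by exists (fun p : 'I_n * 'I_n => (p.2, p.1)) => -[].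
  rewrite [X in _ + X](eq_bigl (fun p : 'I_n * 'I_n => p.1 < p.2)%N); last first.
    by case=> i j /=; rewrite -leqNgt; case: ltngtP.
  rewrite -big_split /= (big_sub (fun p : 'I_n * 'I_n => p.1 < p.2)%N).
  apply: eq_bigr => -[[i j] /= ij] _; rewrite ffunE /= !aE.
  by rewrite [f e`_j _]fN scalerN -scalerBl.
have delta (p : I) : coord_wedge e`_(val p).1 e`_(val p).2 =
    [ffun q => (p == q)%:R] :> {ffun I -> F^o}.
  apply/ffunP=> q; rewrite !ffunE !coord_free ?(basis_free (vbasisP _)) //.
  have -> : (p == q) = (val p == val q) by [].
  case: p q => [[i j] /= ij] [[k l] /= kl]; rewrite xpair_eqE.
  have jk_il : (j == k) && (i == l) = false.
    by apply/negbTE/negP=> /andP[/eqP jk /eqP il]; subst; move: ij kl; lia.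
  by rewrite -!natrM !mulnb [(i == l) && _]andbC jk_il subr0.
have wE : w = \sum_(p : I) w p *: coord_wedge e`_(val p).1 e`_(val p).2.
  apply/ffunP=> q; rewrite sum_ffunE (bigD1 q) //= big1 => [|p /negPf pq].
    by rewrite addr0 delta !ffunE eqxx /GRing.scale /= mulr1.
  by rewrite delta !ffunE pq /GRing.scale /= mulr0.
rewrite {1}wE linear_sum; apply: eq_bigr => p _.
by rewrite linearZ /= g'E.
Qed.

End Existence.

(* Main.v *)
Require Import Defs.
From HB Require Import structures.
From mathcomp Require Import all_boot all_order all_algebra.

(** A map of rank one on a 3-space has a plane as its kernel, so a basis u, v
    of the kernel and any w outside it form a basis of the whole space, and
    the map is determined by the image of w.  Wedge products of basis vectors
    span the exterior square ([wedge_basis3]), so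
      pi w = a (w /\ u) + b (w /\ v) + c (u /\ v).
    If a = b = 0, this is (c u) /\ v, and c is nonzero because pi w is.
    Otherwise x = a u + b v is a nonzero kernel vector, so x and one of u, v,
    say y, form a basis of the kernel; as the exterior square of a plane is a
    line, c (u /\ v) = d (x /\ y) for some d, and
      pi w = w /\ x + d (x /\ y) = (w - d y) /\ x.
    Replacing w by w - d y does not change its image, since y is in the
    kernel ([normal_form_of_wedge_coef]). *)

Set Implicit Arguments.
Unset Strict Implicit.
Unset Printing Implicit Defensive.

Import GRing.Theory.
Local Open Scope ring_scope.

Lemma alternatingN (F : fieldType) (V W : lmodType F)
    (f : {bilinear V -> V -> W}) (f_alt : alternating f) u v :
  f v u = - f u v.
Proof.
apply/eqP; rewrite -addr_eq0; apply/eqP.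
have := f_alt (u + v); rewrite linearDr !linearDl /= !f_alt.
by rewrite add0r addr0 addrC.
Qed.

(** Uniqueness in the universal property: the identity and the projection onto
    U both factor the wedge product through itself, so they coincide. *)
Lemma exterior_square_spanned (F : fieldType) (V W : vectType F)
    (wedge : {bilinear V -> V -> W}) (U : {vspace W}) :
    is_exterior_square wedge -> (forall u v, wedge u v \in U) ->
  U = fullv.
Proof.
case=> alt univ wedgeU; have [g [_ g_uniq]] := univ W wedge alt.
have projE : projv U =1 g by apply: g_uniq => u v; apply: projv_id.
have idE : \1%VF =1 g by apply: g_uniq => u v; apply: id_lfunE.
apply/eqP; rewrite eqEsubv subvf; apply/subvP=> z _.
by rewrite -[z](id_lfunE z) [_ z]idE -projE memv_proj.
Qed.

Lemma mem_span3P (F : fieldType) (V : vectType F) (x y z t : V) :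
  t \in <<[:: x; y; z]>>%VS -> exists a b c, t = a *: x + b *: y + c *: z.
Proof.
rewrite !span_cons span_nil addv0.
case/memv_addP=> _ /vlineP[a ->] [s /memv_addP[_ /vlineP[b ->]]].
by case=> _ /vlineP[c ->] -> ->; exists a, b, c; rewrite addrA.
Qed.

Lemma wedge_basis3 (F : fieldType) (V W : vectType F)
    (wedge : {bilinear V -> V -> W}) (x y z : V) :
    is_exterior_square wedge -> basis_of {:V} [:: x; y; z] ->
  forall t, exists a b c,
    t = a *: wedge x y + b *: wedge x z + c *: wedge y z.
Proof.
move=> ext xyz t; have [alt _] := ext.
apply: mem_span3P; set S := <<_>>%VS.
suff -> : S = fullv by rewrite memvf.
apply: (exterior_square_spanned ext) => u v.
have wN := alternatingN alt.
have [Sxy Sxz Syz] : [/\ wedge x y \in S, wedge x z \in S & wedge y z \in S].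
  by split; apply: memv_span; rewrite !inE eqxx ?orbT.
have inV s : s \in <<[:: x; y; z]>>%VS by rewrite (span_basis xyz) memvf.
have [a [b [c ->]]] := mem_span3P (inV u).
have [a' [b' [c' ->]]] := mem_span3P (inV v).
rewrite !(linearDr, linearDl) /= !(linearZl_LR, linearZr_LR) /= !alt.
rewrite (wN x y) (wN x z) (wN y z).
by rewrite !(memvD, memvZ, memvN, mem0v).
Qed.

Lemma basis_of_exchange (F : fieldType) (V : vectType F) (X Y : seq V) :
    basis_of {:V} X -> size Y = size X -> {subset X <= <<Y>>%VS} ->
  basis_of {:V} Y.
Proof.
move=> Xbasis sYX XY; rewrite basisEdim sYX -(size_basis (X := in_tuple X) Xbasis) leqnn andbT.
by rewrite -(span_basis Xbasis); apply/span_subvP.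
Qed.

Lemma rank1_basis3 (F : fieldType) (V W : vectType F) (f : 'Hom(V, W)) :
    \dim {:V} = 3%N -> \dim (limg f) = 1%N ->
  exists w u v, [/\ basis_of {:V} [:: w; u; v], f u = 0, f v = 0 & f w != 0].
Proof.
move=> dimV rank1.
have dimK : \dim (lker f) = 2%N.
  by have := limg_ker_dim f fullv; rewrite capfv rank1 dimV addn1 => -[].
have [w fw] : exists w, f w != 0.
  have /memv_imgP[w _ fw] := memv_pick (limg f).
  by exists w; rewrite -fw vpick0 -dimv_eq0 rank1.
have := vbasisP (lker f); case: (vbasis _) => s /=; rewrite dimK.
case: s => [|u [|v [|//]]] //= _ uvK; exists w, u, v.
have fK t : t \in [:: u; v] -> f t = 0.
  by move=> /(basis_mem uvK); rewrite memv_ker => /eqP.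
split=> //; try by apply: fK; rewrite !inE eqxx ?orbT.
rewrite basisEfree subvf dimV /= andbT free_cons (basis_free uvK) andbT.
by rewrite (span_basis uvK) memv_ker.
Qed.

(** With x = a u + b v, the product (w - (c / a) v) /\ x is the given image of
    w: the correction term contributes - c (v /\ u). *)
Lemma normal_form_of_wedge_coef (F : fieldType) (V W : vectType F)
    (wedge : {bilinear V -> V -> W}) (f : 'Hom(V, W)) (w u v : V) (a b c : F) :
    alternating wedge -> basis_of {:V} [:: w; u; v] ->
    f u = 0 -> f v = 0 -> a != 0 ->
    f w = a *: wedge w u + b *: wedge w v + c *: wedge u v ->
  exists v1 v2 v3,
    [/\ basis_of {:V} [:: v1; v2; v3], f v2 = 0, f v3 = 0
      & f v1 = wedge v1 v2].
Proof.
move=> alt wuv fu fv a0 fw.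
exists (w - (c / a) *: v), (a *: u + b *: v), v; split=> //.
- apply: (basis_of_exchange wuv) => // t; set S := <<_>>%VS.
  have [S1 S2 S3] : [/\ w - (c / a) *: v \in S, a *: u + b *: v \in S & v \in S].
    by split; apply: memv_span; rewrite !inE eqxx ?orbT.
  rewrite !inE => /or3P[] /eqP-> //.
    by rewrite -[w](subrK ((c / a) *: v)) memvD ?memvZ.
  rewrite -[u](scalerK a0) memvZ //.
  by rewrite -[a *: u](addrK (b *: v)) memvD ?memvN ?memvZ.
- by rewrite linearD !linearZ /= fu fv !scaler0 addr0.
rewrite linearB linearZ /= fv scaler0 subr0 fw.
rewrite linearDr linearBl /= linearBl /= !(linearZl_LR, linearZr_LR) /= alt.
rewrite !scaler0 subr0 (alternatingN alt u v) !scalerN opprK scalerA.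
by rewrite divfK // addrAC.
Qed.

Theorem proposition3p3 (p : nat) (p_prime : prime p) (p_odd : odd p)
    (V : vectType 'F_p) (dimV : \dim {:V} = 3%N)
    (L2V : vectType 'F_p) (wedge : {bilinear V -> V -> L2V})
    (L2V_ext : is_exterior_square wedge)
    (pi : 'Hom(V, L2V)) (rank_pi : \dim (limg pi) = 1%N) :
  exists v1 v2 v3 : V,
    [/\ basis_of {:V} [:: v1; v2; v3],
        pi v2 = 0,
        pi v3 = 0 &
        pi v1 = wedge v1 v2 \/ pi v1 = wedge v2 v3].
Proof.
have [alt _] := L2V_ext.
have [w [u [v [wuv pu pv pw0]]]] := rank1_basis3 dimV rank_pi.
have [a [b [c pw]]] := wedge_basis3 L2V_ext wuv (pi w).
have [a0 | a_neq0] := eqVneq a 0; last first.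
  have [v1 [v2 [v3 [B p2 p3 p1]]]] :=
    normal_form_of_wedge_coef alt wuv pu pv a_neq0 pw.
  by exists v1, v2, v3; split=> //; left.
have [b0 | b_neq0] := eqVneq b 0; last first.
  (* Exchanging u and v brings the nonzero coefficient to the front. *)
  have wvu : basis_of {:V} [:: w; v; u].
    apply: (basis_of_exchange wuv) => // t tX; apply: memv_span.
    by move: tX; rewrite !inE [(t == v) || _]orbC.
  have pw' : pi w = b *: wedge w v + a *: wedge w u + (- c) *: wedge v u.
    by rewrite (alternatingN alt u v) scaleNr scalerN opprK pw [X in X + _]addrC.
  have [v1 [v2 [v3 [B p2 p3 p1]]]] :=
    normal_form_of_wedge_coef alt wvu pv pu b_neq0 pw'.
  by exists v1, v2, v3; split=> //; left.
rewrite a0 b0 !scale0r !add0r in pw.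
have c_neq0 : c != 0 by apply: contraNneq pw0 => c0; rewrite pw c0 scale0r.
exists w, (c *: u), v; split=> //.
- apply: (basis_of_exchange wuv) => // t; set S := <<_>>%VS.
  have [S1 S2 S3] : [/\ w \in S, c *: u \in S & v \in S].
    by split; apply: memv_span; rewrite !inE eqxx ?orbT.
  rewrite !inE => /or3P[] /eqP-> //.
  by rewrite -[u](scalerK c_neq0) memvZ.
- by rewrite linearZ /= pu scaler0.
by right; rewrite linearZl_LR.
Qed.
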